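(* Let $p,q$ be positive integers such that either $p,q\ge 6$, or $q>p(p-1)$. Then $\overrightarrow{\beta}(K_{p,q},1)=\min\{p,q\}$, where $K_{p,q}$ is the complete bipartite graph with parts of sizes $p$ and $q$.
   Context: Firefighting on oriented graphs: an orientation $\overrightarrow{G}$ of a finite simple graph $G$ replaces each edge $uv$ by exactly one of the arcs $\overrightarrow{uv}$, $\overrightarrow{vu}$. Let $f\ge 1$ be an integer. A fire breaks out at a vertex $v$ at time $1$ ($v$ burns). At the end of each time unit, the firefighters permanently protect up to $f$ vertices that are neither burning nor already protected. At the next time unit, every vertex that is neither burning nor protected and is an out-neighbour of a burning vertex starts to burn. The process ends when no new vertex can burn. $\beta(\overrightarrow{G},f)$ is the maximum, over all starting vertices $v$, of the minimum, over all protection strategies, of the number of vertices that burn. $\overrightarrow{\beta}(G,f)$ is the minimum of $\beta(\overrightarrow{G},f)$ over all orientations $\overrightarrow{G}$ of $G$. *)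

(* Defs.v *)
From mathcomp Require Import all_boot.
Set Implicit Arguments.
Unset Strict Implicit.
Unset Printing Implicit Defensive.

Record sgraph := SGraph {
  vertex :> finType;
  edge : rel vertex;
  edge_sym : symmetric edge;
  edge_irrefl : irreflexive edge }.

Definition Kpq_edge (p q : nat) : rel ('I_p + 'I_q)%type :=
  fun x y => match x, y with
  | inl _, inr _ | inr _, inl _ => true
  | _, _ => false
  end.

Lemma Kpq_edge_sym p q : symmetric (@Kpq_edge p q).
Proof. by case=> ? []. Qed.

Lemma Kpq_edge_irrefl p q : irreflexive (@Kpq_edge p q).
Proof. by case. Qed.

Definition Kpq (p q : nat) : sgraph :=
  SGraph (@Kpq_edge_sym p q) (@Kpq_edge_irrefl p q).

(* An arc set; (u, v) \in D stands for the arc from u to v. *)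
Definition is_orientation (G : sgraph) (D : {set G * G}) : bool :=
  [forall u, forall v,
     if edge u v then ((u, v) \in D) (+) ((v, u) \in D)
     else (u, v) \notin D].

Lemma bigminn_leq (I : finType) (P : pred I) (F : I -> nat) m i :
  P i -> \big[minn/m]_(j | P j) F j <= F i.
Proof.
move=> Pi; rewrite -big_filter.
have: i \in [seq j <- index_enum I | P j] by rewrite mem_filter Pi mem_index_enum.
elim: [seq _ <- _ | _] => //= j r IHr.
rewrite inE big_cons geq_min => /orP[/eqP <-|/IHr ->]; first by rewrite leqnn.
by rewrite orbT.
Qed.

Section Firefighting.
Variables (T : finType) (D : {set T * T}).

(* A plan s protects s t at the end of time unit t.+1, so that the vertices  *)
(* protected before the end of time unit t.+1 are those of protected s t.    *)
Definition protected (s : nat -> {set T}) (t : nat) : {set T} :=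
  \bigcup_(i < t) s i.

(* The vertices on fire at time t.+1, the fire breaking out at v at time 1.  *)
Fixpoint burning (s : nat -> {set T}) (v : T) (t : nat) : {set T} :=
  if t is t'.+1 then
    burning s v t' :|:
    [set w | (w \notin protected s t'.+1) &&
             [exists u in burning s v t', (u, w) \in D]]
  else [set v].

Definition legal_at (f : nat) (s : nat -> {set T}) (v : T) (t : nat) : bool :=
  (#|s t| <= f) && [disjoint s t & burning s v t :|: protected s t].

(* The fire stops spreading after fewer than #|T| time units (see            *)
(* burning_stable below), so it is enough to plan that many protections.     *)
Definition strategy := #|T|.-tuple {set T}.

Definition plan (s : strategy) : nat -> {set T} := nth set0 s.

Definition legal (f : nat) (v : T) (s : strategy) : bool :=
  [forall t : 'I_#|T|, legal_at f (plan s) v t].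

Definition burnt (v : T) (s : strategy) : {set T} := burning (plan s) v #|T|.

(* The default value #|T| of the minimum plays no role: it bounds every term *)
(* and the strategy that protects nothing is legal.                          *)
Definition min_burnt (f : nat) (v : T) : nat :=
  \big[minn/#|T|]_(s : strategy | legal f v s) #|burnt v s|.

Definition beta (f : nat) : nat := \max_(v : T) min_burnt f v.

Lemma burning_mono s v t t' :
  t <= t' -> burning s v t \subset burning s v t'.
Proof.
move/subnK <-; elim: (t' - t) => [|k IHk] //.
by rewrite addSn /= (subset_trans IHk) // subsetUl.
Qed.

Lemma burning_fix s v t k :
  burning s v t.+1 = burning s v t -> burning s v (k + t) = burning s v t.
Proof.
move=> Et; elim: k => [|k IHk] //; apply/eqP; rewrite eqEsubset.
rewrite [X in _ && X]burning_mono ?leq_addl // andbT addSn /= IHk subUset.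
rewrite subxx /=.
apply/subsetP=> w; rewrite inE => /andP[wP wN]; rewrite -Et /= !inE wN andbT.
apply/orP; right; apply: contra wP => /bigcupP[i _ wi].
have lei : i < (k + t).+1 by rewrite (leq_trans (ltn_ord i)) // ltnS leq_addl.
by apply/bigcupP; exists (Ordinal lei).
Qed.

Lemma burning_stable s v t : burning s v t \subset burning s v #|T|.
Proof.
have [/burning_mono //|lt_nt] := leqP t #|T|.
suff [k le_kn Ek] : exists2 k, k <= #|T| & burning s v k.+1 = burning s v k.
  rewrite -[t](@subnK k) ?(leq_trans le_kn) ?(ltnW lt_nt) //.
  by rewrite burning_fix // burning_mono.
have [/existsP[k /eqP Ek]|noK] :=
    boolP [exists k : 'I_#|T|.+1, burning s v k.+1 == burning s v k].
  by exists k => //; rewrite -ltnS.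
suff: #|T|.+1 <= #|burning s v #|T| | by rewrite ltnNge max_card.
have: #|T| <= #|T| by [].
elim: {1 3 4}#|T| => [|k IHk] ltk; first by rewrite cards1.
apply: leq_ltn_trans (IHk (ltnW ltk)) _; apply: proper_card.
rewrite properEneq burning_mono // andbT eq_sym.
by move/existsPn: noK => /(_ (Ordinal (ltnW ltk : k < #|T|.+1))).
Qed.

Lemma protected_ext s1 s2 n t :
  (forall i, i < n -> s1 i = s2 i) -> t <= n -> protected s1 t = protected s2 t.
Proof.
by move=> E le_tn; apply: eq_bigr => i _; apply: E (leq_trans (ltn_ord i) le_tn).
Qed.

Lemma burning_ext s1 s2 v n t :
  (forall i, i < n -> s1 i = s2 i) -> t <= n -> burning s1 v t = burning s2 v t.
Proof.
move=> E; elim: t => [|t IHt] //= lt_tn.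
by rewrite IHt ?(ltnW lt_tn) // (protected_ext E lt_tn).
Qed.

Lemma legal_at_ext s1 s2 f v n t :
    (forall i, i < n -> s1 i = s2 i) -> t < n ->
  legal_at f s1 v t = legal_at f s2 v t.
Proof.
move=> E lt_tn; have le_tn := ltnW lt_tn.
by rewrite /legal_at E // (burning_ext v E le_tn) (protected_ext E le_tn).
Qed.

Lemma min_burntP f v k :
  reflect (exists2 s : nat -> {set T}, (forall t, legal_at f s v t)
                                     & forall t, #|burning s v t| <= k)
          (min_burnt f v <= k).
Proof.
apply: (iffP idP) => [|[s sL sk]]; last first.
  pose s' : strategy := [tuple s i | i < #|T|].
  have E i : i < #|T| -> plan s' i = s i.
    by move=> lt_i; rewrite /plan -[i]/(nat_of_ord (Ordinal lt_i)) nth_mktuple.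
  have s'L : legal f v s'.
    by apply/forallP=> t; rewrite (legal_at_ext f v E) // sL.
  apply: leq_trans (bigminn_leq _ _ s'L) _.
  by rewrite /burnt (burning_ext v E).
have plan_legal s t : legal f v s -> legal_at f (plan s) v t.
  move/forallP=> sL; have [lt_tn|le_nt] := ltnP t #|T|.
    exact: sL (Ordinal lt_tn).
  by rewrite /legal_at /plan nth_default ?size_tuple // cards0 disjoints_subset sub0set.
suff [s sL ->] : exists2 s, legal f v s & min_burnt f v = #|burnt v s|.
  move=> le_k; exists (plan s) => t; first exact: plan_legal.
  exact: leq_trans (subset_leq_card (burning_stable _ _ _)) le_k.
pose s0 : strategy := [tuple set0 | i < #|T|].
have s0L : legal f v s0.
  apply/forallP=> t; rewrite /legal_at /plan nth_mktuple cards0.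
  by rewrite disjoints_subset sub0set.
case: (@arg_minnP _ s0 (legal f v) (fun s => #|burnt v s|) s0L) => s sL sM.
exists s => //; apply/eqP; rewrite eqn_leq; apply/andP; split.
  exact: bigminn_leq.
apply: (big_ind (fun m => #|burnt v s| <= m)) => [|m n Hm Hn|//].
  exact: max_card.
by rewrite leq_min Hm.
Qed.

End Firefighting.

(* As above, the default value #|G| is harmless: orientations exist, and     *)
(* beta D f <= #|G|.                                                         *)
Definition obeta (G : sgraph) (f : nat) : nat :=
  \big[minn/#|G|]_(D : {set G * G} | is_orientation D) beta D f.

Lemma orientation_exists (G : sgraph) : exists D : {set G * G}, is_orientation D.
Proof.
exists [set x | edge x.1 x.2 && (enum_rank x.1 < enum_rank x.2)].
apply/forallP=> u; apply/forallP=> v; rewrite !inE /= [edge v u]edge_sym.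
case Euv: (edge u v) => //=; case: ltngtP => // /ord_inj/enum_rank_inj Eq.
by rewrite Eq edge_irrefl in Euv.
Qed.

Lemma beta_le_card (T : finType) (D : {set T * T}) f : beta D f <= #|T|.
Proof.
apply/bigmax_leqP=> v _; rewrite /min_burnt.
apply: (big_ind (fun m => m <= #|T|)) => // [m n Hm _|s _]; last exact: max_card.
by rewrite geq_min Hm.
Qed.

(* Main.v *)
Require Import Defs.
From mathcomp Require Import all_boot zify.

(* Upper bound: orient every edge from the larger part to the smaller one.

   Lower bound: suppose that every fire can be kept below p burnt vertices,
   p being the size of the smaller part.  Then every out-degree is below p, and
   summing the out-degrees already excludes q > p (p - 1).  For p, q >= 6, let u
   have maximum out-degree d; the degree sum gives p <= 2 d.  A fire at u yields
   a set X of d - 1 out-neighbours of u whose joint out-neighbourhood R has at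
   most p - d vertices.  Let Y be the complement of R in the part of u, and Z
   the complement of X in the other part.  Every vertex of Y sends arcs to all
   of X, hence at most one arc to Z, while |Y| >= d.
   - If every vertex of Z receives an arc from Y, some z in Z has at least three
     out-neighbours in Y, and a fire at z burns almost all of the part of z two
     steps later.
   - Otherwise some z in Z has Y as its exact out-neighbourhood.  A fire at z
     burns at least 2 d - 2 vertices of z, Y, X, so 2 d is p or p + 1.  If
     2 d = p, every out-degree is d, and the fire goes on into R.  If
     2 d = p + 1, the fire must stop in X, which makes the out-degrees on X and
     Y too small for the degree sum. *)

Set Implicit Arguments.
Unset Strict Implicit.
Unset Printing Implicit Defensive.

(* Abstracting the cardinals keeps [lia] from comparing sets up to conversion. *)
Ltac cards_lia :=
  repeat match goal with |- context [#|?S|] => generalize #|S| end; clear; lia.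

(** * Out-neighbourhoods and the first steps of a contained fire *)

Section Outneighbours.
Variables (T : finType) (D : {set T * T}).

Definition out (v : T) : {set T} := [set w | (v, w) \in D].
Definition outs (S : {set T}) : {set T} := \bigcup_(v in S) out v.

Lemma outsP (S : {set T}) w :
  reflect (exists2 u, u \in S & (u, w) \in D) (w \in outs S).
Proof.
by apply: (iffP bigcupP) => -[u uS uw]; exists u => //; rewrite inE in uw *.
Qed.

Lemma outsS (S1 S2 : {set T}) : S1 \subset S2 -> outs S1 \subset outs S2.
Proof.
move=> /subsetP S12; apply/subsetP => w /outsP[u /S12 uS uw].
by apply/outsP; exists u.
Qed.

Lemma mem_burningS s v t u w :
    u \in burning D s v t -> (u, w) \in D -> w \notin protected s t.+1 ->
  w \in burning D s v t.+1.
Proof.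
move=> uB uw wP /=; rewrite !inE wP /=; apply/orP; right.
by apply/existsP; exists u; rewrite uB.
Qed.

(** [s0], [s1], [s2] are the first three moves of one good strategy. They are fixed before [S1],
    [S2], [S3], which can thus be chosen against them; these sets burn by times 2, 3 and 4. *)
Lemma fire_contained p v : beta D 1 < p ->
  exists s0 s1 s2 : {set T}, [/\ #|s0| <= 1, #|s1| <= 1, #|s2| <= 1 &
    forall S1 S2 S3 : {set T}, S1 \subset out v :\: s0 ->
      S2 \subset outs S1 :\: (s0 :|: s1) ->
      S3 \subset outs S2 :\: (s0 :|: s1 :|: s2) ->
      #|v |: S1 :|: S2 :|: S3| < p].
Proof.
move=> bp; have p0 : 0 < p by case: p bp.
have : min_burnt D 1 v <= p.-1.
  by rewrite -ltnS prednK //; apply: leq_ltn_trans bp; apply: leq_bigmax.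
case/min_burntP => s sL sk; exists (s 0), (s 1), (s 2).
have sc t : #|s t| <= 1 by case/andP: (sL t).
split=> // S1 S2 S3 /subsetP h1 /subsetP h2 /subsetP h3.
have P1 : protected s 1 = s 0 by rewrite /protected big_ord_recr big_ord0 /= set0U.
have P2 : protected s 2 = s 0 :|: s 1.
  by rewrite -P1 /protected [in LHS]big_ord_recr.
have P3 : protected s 3 = s 0 :|: s 1 :|: s 2.
  by rewrite -P2 /protected [in LHS]big_ord_recr.
have b0 : v \in burning D s v 0 by rewrite /= inE.
have b1 : {subset S1 <= burning D s v 1}.
  move=> w /h1 /setDP[vw ws]; rewrite inE in vw.
  by apply: mem_burningS b0 vw _; rewrite P1.
have b2 : {subset S2 <= burning D s v 2}.
  move=> w /h2 /setDP[/outsP[u /b1 uS uw] ws].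
  by apply: mem_burningS uS uw _; rewrite P2.
have b3 : {subset S3 <= burning D s v 3}.
  move=> w /h3 /setDP[/outsP[u /b2 uS uw] ws].
  by apply: mem_burningS uS uw _; rewrite P3.
apply: leq_ltn_trans (_ : p.-1 < p); last by rewrite prednK.
apply: leq_trans (sk 3); apply: subset_leq_card.
have mono t : t <= 3 -> {subset burning D s v t <= burning D s v 3}.
  by move=> t3; apply/subsetP/burning_mono.
apply/subsetP => w /setUP[/setUP[/setU1P[->|/b1]|/b2]|/b3] //.
- exact: mono b0.
- exact: mono.
- exact: mono.
Qed.

(** At time 2 the fire holds [v] and all its out-neighbours but at most one. *)
Lemma out_lt p v : beta D 1 < p -> (v, v) \notin D -> #|out v| < p.
Proof.
move=> bp vv; have [s0 [s1 [s2 [c0 _ _ H]]]] := fire_contained v bp.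
have := H (out v :\: s0) set0 set0 (subxx _) (sub0set _) (sub0set _).
rewrite !setU0 cardsU1 !inE (negPf vv) andbF /=; apply: leq_trans.
by have := cardsD (out v) s0; have := subset_leq_card (subsetIr (out v) s0); lia.
Qed.

End Outneighbours.

(** * Bipartite tournaments: degree sums and second out-neighbourhoods *)

Section BipartiteTournament.
Variables (T : finType) (D : {set T * T}) (side : T -> bool).
Hypothesis arc_side : forall x y, (x, y) \in D -> side y = ~~ side x.
Hypothesis arc_total :
  forall x y, side y = ~~ side x -> ((x, y) \in D) = ((y, x) \notin D).

Local Notation out := (out D).
Local Notation outs := (outs D).

Definition on (b : bool) : {set T} := [set x | side x == b].

Lemma arc_asym x y : (x, y) \in D -> (y, x) \notin D.
Proof. by move=> xy; rewrite -arc_total // (arc_side xy). Qed.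

Lemma arc_loop x : (x, x) \notin D.
Proof. by apply/negP => /arc_side; case: (side x). Qed.

(** Double counting: each pair of a vertex of [S] and one of [U] carries exactly one arc, counted at
    its tail. *)
Lemma sum_out_cross b (S U : {set T}) : S \subset on b -> U \subset on (~~ b) ->
  \sum_(x in S) #|out x :&: U| + \sum_(y in U) #|out y :&: S| = #|S| * #|U|.
Proof.
move=> /subsetP hS /subsetP hU.
have card_out x (V : {set T}) : #|out x :&: V| = \sum_(y in V) ((x, y) \in D).
  rewrite -sum1_card (big_mkcond (mem (_ :&: _))) [RHS]big_mkcond.
  by apply: eq_bigr => y _; rewrite !inE andbC; case: (y \in V) => //; case: (_ \in D).
under eq_bigr => x _ do rewrite card_out.
under [X in _ + X]eq_bigr => x _ do rewrite card_out.
rewrite [X in _ + X]exchange_big -big_split /=.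
under eq_bigr => x xS do rewrite -big_split /=.
rewrite -sum_nat_const; apply: eq_bigr => x /hS; rewrite inE => /eqP sx.
rewrite -sum1_card; apply: eq_bigr => y /hU; rewrite inE => /eqP sy.
by rewrite arc_total ?sx //; case: (_ \in D).
Qed.

Lemma out_sub v : out v \subset on (~~ side v).
Proof. by apply/subsetP => w; rewrite !inE => /arc_side ->. Qed.

Lemma sum_out b : \sum_(v : T) #|out v| = #|on b| * #|on (~~ b)|.
Proof.
rewrite -(sum_out_cross (subxx (on b)) (subxx _)).
rewrite (bigID (mem (on b))) /=; congr (_ + _).
  apply: eq_bigr => x; rewrite inE => /eqP <-.
  by rewrite (setIidPl (out_sub x)).
apply: eq_big => [x|x]; first by rewrite !inE; case: (side x); case: b.
rewrite inE => sx; have /setIidPl := out_sub x.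
have -> : ~~ side x = b by case: (side x) sx; case: (b).
by move->.
Qed.

(** Sides alternate along the fire, so only [v] and [S2], or [S1] and [S3], could overlap; with both
    excluded, the cardinals add up. *)
Lemma fire_contained_bip p v : beta D 1 < p ->
  exists s0 s1 s2 : {set T}, [/\ #|s0| <= 1, #|s1| <= 1, #|s2| <= 1 &
    forall S1 S2 S3 : {set T}, S1 \subset out v :\: s0 ->
      S2 \subset outs S1 :\: (s0 :|: s1) -> v \notin S2 ->
      S3 \subset outs S2 :\: (s0 :|: s1 :|: s2) -> [disjoint S1 & S3] ->
      1 + #|S1| + #|S2| + #|S3| < p].
Proof.
move=> bp; have [s0 [s1 [s2 [c0 c1 c2 H]]]] := fire_contained v bp.
exists s0, s1, s2; split=> // S1 S2 S3 h1 h2 vS2 h3 dS.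
apply: leq_ltn_trans (H _ _ _ h1 h2 h3).
have S1s x : x \in S1 -> side x = ~~ side v.
  by move=> /(subsetP h1); rewrite !inE => /andP[_ /arc_side].
have S2s x : x \in S2 -> side x = side v.
  move=> /(subsetP h2); rewrite inE => /andP[_ /outsP[u /S1s su /arc_side ->]].
  by rewrite su negbK.
have S3s x : x \in S3 -> side x = ~~ side v.
  by move=> /(subsetP h3); rewrite inE => /andP[_ /outsP[u /S2s su /arc_side ->]];
  rewrite su.
rewrite cardsU cardsU cardsU1.
have -> : v \notin S1 by apply/negP => /S1s; case: (side v).
have -> : (v |: S1) :&: S2 = set0.
  apply/setP => x; rewrite !inE; apply/negP => /andP[/orP[/eqP->|/S1s s1x] xS2].
    by rewrite xS2 in vS2.
  by move: (S2s _ xS2); rewrite s1x; case: (side v).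
have -> : ((v |: S1) :|: S2) :&: S3 = set0.
  apply/setP => x; rewrite !inE; apply/negP => /andP[/orP[/orP[/eqP->|x1]|/S2s s2x] x3].
  - by move: (S3s _ x3); case: (side v).
  - by have := disjointFr dS x1; rewrite x3.
  - by move: (S3s _ x3); rewrite s2x; case: (side v).
by rewrite cards0 !subn0.
Qed.

Lemma outs_sub b (S : {set T}) : S \subset on b -> outs S \subset on (~~ b).
Proof.
move=> /subsetP hS; apply/subsetP => w /outsP[u /hS]; rewrite !inE => /eqP <-.
by move/arc_side ->.
Qed.

Lemma card_sides b : #|T| = #|on b| + #|on (~~ b)|.
Proof.
rewrite -(cardsC (on b)); congr (_ + #|pred_of_set _|); apply/setP => x.
by rewrite !inE; case: (side x); case: b.
Qed.

Lemma small_second_neighbourhood p u : beta D 1 < p -> 0 < #|out u| ->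
  exists2 X : {set T}, X \subset out u
    & #|X|.+1 = #|out u| /\ #|outs X| + #|out u| <= p.
Proof.
move=> bp d0; have [s0 [s1 [s2 [c0 c1 _ H]]]] := fire_contained_bip u bp.
set X0 := out u :\: s0; set R0 := outs X0.
have X0u : X0 \subset out u by rewrite subsetDl.
have uR0 : u \notin R0.
  apply/negP => /outsP[x /(subsetP X0u)]; rewrite inE => ux.
  by apply/negP; apply: arc_asym.
have := H X0 (R0 :\: (s0 :|: s1)) set0 (subxx _) (subxx _) _ (sub0set _) _.
rewrite !inE (negPf uR0) andbF => /(_ isT); rewrite -setI_eq0 setI0 => /(_ (eqxx _)).
rewrite cards0 addn0 => H1.
(* [out u] and [R0] lie on opposite sides, so [s0] saves a vertex of at most one of them; [s1] saves
   at most one more vertex of [R0]. *)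
have r0 : #|R0| + #|out u| <= p.
  have := cardsD (out u) s0; rewrite -/X0.
  have := cardsD R0 (s0 :|: s1).
  have := subset_leq_card (subsetIl (out u) s0).
  have := subset_leq_card (subsetIl R0 (s0 :|: s1)).
  have : #|R0 :&: (s0 :|: s1)| <= #|R0 :&: s0| + #|s1|.
    rewrite setIUr (leq_trans (leq_card_setU _ _)) // leq_add2l.
    by rewrite subset_leq_card // subsetIr.
  have : #|out u :&: s0| + #|R0 :&: s0| <= #|s0|.
    rewrite -cardsUI [X in _ + #|pred_of_set X|](_ : _ = set0).
      by rewrite cards0 addn0 subset_leq_card // subUset !subsetIr.
    apply/setP => x; rewrite in_set0; apply/negP => /setIP[/setIP[xu _] /setIP[xR _]].
    have := subsetP (outs_sub (subset_trans X0u (out_sub u))) x xR.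
    by have := subsetP (out_sub u) x xu; rewrite !inE; case: (side x); case: (side u).
  lia.
have [s0u|/set0Pn[x xs]] := eqVneq (out u :&: s0) set0; last first.
  exists X0 => //; split=> //; have := cardsD (out u) s0; rewrite -/X0.
  have : 0 < #|out u :&: s0| by apply/card_gt0P; exists x.
  have := subset_leq_card (subsetIr (out u) s0); lia.
(* Here [X0] is all of [out u]; dropping any vertex gives the required size and can only shrink the
   joint out-neighbourhood. *)
have [x xu] := card_gt0P d0; exists (out u :\ x); first by rewrite subsetDl.
split; first by rewrite [RHS](cardsD1 x) xu.
apply: leq_trans r0; rewrite leq_add2r subset_leq_card // outsS //.
apply/subsetP => y /setD1P[_ yu]; apply/setDP; split=> //; apply/negP => ys.
by have := in_set0 y; rewrite -s0u inE yu ys.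
Qed.

(** * Contradictions around a vertex of maximum out-degree *)

Section Extremal.
Variables (p d : nat) (u : T) (X : {set T}).
Hypothesis p6 : 6 <= p.
Hypothesis side_ge : forall b, p <= #|on b|.
Hypothesis bp : beta D 1 < p.
Hypothesis out_le : forall v, #|out v| <= d.
Hypothesis d_lt : d < p.
Hypothesis Xu : X \subset out u.
Hypothesis cardX : #|X|.+1 = d.
Hypothesis cardR : #|outs X| + d <= p.

Let A := on (side u).
Let B := on (~~ side u).
Let R := outs X.
Let Y := A :\: R.
Let Z := B :\: X.

Let XB : X \subset B. Proof. exact: subset_trans Xu (out_sub u). Qed.
Let RA : R \subset A. Proof. by have := outs_sub XB; rewrite negbK. Qed.
Let YA : Y \subset A. Proof. exact: subsetDl. Qed.
Let ZB : Z \subset B. Proof. exact: subsetDl. Qed.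

Let A_side x : (x \in A) = (side x == side u). Proof. by rewrite inE. Qed.
Let B_side x : (x \in B) = (side x == ~~ side u). Proof. by rewrite inE. Qed.

(** The sets [Y], [R], [X], [Z] partition the vertices. Applied to [s0], [s1], [s2], this lets [lia]
    share out the protected vertices. *)
Let card_parts (s : {set T}) :
  #|s| = #|s :&: Y| + #|s :&: R| + (#|s :&: X| + #|s :&: Z|).
Proof.
have eB : s :\: A = s :&: B.
  by apply/setP => x; rewrite !inE; case: (x \in s); case: (side x); case: (side u).
have eR : s :&: A :&: R = s :&: R by rewrite -setIA (setIidPr RA).
have eX : s :&: B :&: X = s :&: X by rewrite -setIA (setIidPr XB).
rewrite -(cardsID A s) eB -(cardsID R (s :&: A)) -(cardsID X (s :&: B)) eR eX.
by rewrite -!setIDA -/Y -/Z [#|s :&: R| + _]addnC.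
Qed.

Let cardY : #|Y| + #|R| = #|A|.
Proof. by rewrite -(cardsID R A) (setIidPr RA) addnC. Qed.

Let cardZ : #|Z| + #|X| = #|B|.
Proof. by rewrite -(cardsID X B) (setIidPr XB) addnC. Qed.

Let degree_sum : #|A| * #|B| <= d * (#|A| + #|B|).
Proof.
rewrite -sum_out -card_sides mulnC -sum_nat_const.
exact: leq_sum.
Qed.

(** The degree sum is at most [2 * d] times the larger part, so the smaller part has at most [2 * d]
    vertices. *)
Let d_ge : p <= d.*2.
Proof.
have hA : p <= #|A| by apply: side_ge.
have hB : p <= #|B| by apply: side_ge.
have [AB|/ltnW BA] := leqP #|A| #|B|.
  apply: leq_trans hA _; rewrite -(@leq_pmul2r #|B|); last lia.
  by apply: leq_trans degree_sum _; nia.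
apply: leq_trans hB _; rewrite -(@leq_pmul2l #|A|); last lia.
by apply: leq_trans degree_sum _; nia.
Qed.

Let arcYX y x : y \in Y -> x \in X -> (y, x) \in D.
Proof.
move=> /setDP[yA yR] xX; have xB := subsetP XB _ xX.
rewrite arc_total; first by apply: contra yR => xy; apply/outsP; exists x.
by move: yA xB; rewrite A_side B_side => /eqP -> /eqP ->.
Qed.

Let outY_B y : y \in Y -> out y \subset B.
Proof.
by move=> /(subsetP YA); rewrite A_side /B => /eqP <-; apply: out_sub.
Qed.

Let outY_Z y : y \in Y -> #|out y :&: Z| <= 1.
Proof.
move=> yY; have yB := outY_B yY; have := out_le y.
rewrite -(cardsID X (out y)); have -> : out y :&: X = X.
  by apply/setIidPr/subsetP => x xX; rewrite inE; apply: arcYX.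
have -> : out y :\: X = out y :&: Z by rewrite setIDA (setIidPl yB).
by have := cardX; lia.
Qed.

Lemma not_all_dominated :
  (forall z, z \in Z -> exists2 y, y \in Y & (y, z) \in D) -> False.
Proof.
move=> dom; have hA := side_ge (side u); have hB := side_ge (~~ side u).
have sumYZ : \sum_(y in Y) #|out y :&: Z| <= #|Y|.
  by rewrite -sum1_card; apply: leq_sum => y; apply: outY_Z.
have ZleY : #|Z| <= #|Y|.
  apply: leq_trans sumYZ; apply: leq_trans (_ : #|\bigcup_(y in Y) (out y :&: Z)| <= _).
    apply/subset_leq_card/subsetP => z zZ; have [y yY yz] := dom z zZ.
    by apply/bigcupP; exists y => //; apply/setIP; rewrite inE.
  apply: (big_ind2 (fun (S : {set T}) n => #|S| <= n)) => [|S1 n1 S2 n2 h1 h2|//].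
    by rewrite cards0.
  by apply: leq_trans (leq_card_setU _ _) _; apply: leq_add.
(* Otherwise counting arcs gives [|Y| |Z| <= |Y| + 2 |Z|]. With [|Z| <= |Y|] this forces [|Z| <= 3],
   and the values 3 and 2 contradict [d <= |Y|], [|Z| >= p - d + 1] and [p >= 6]. *)
have [z zZ z3] : exists2 z, z \in Z & 3 <= #|out z :&: Y|.
  apply/exists_inP; apply: contraT => /exists_inPn small.
  have sumZY : \sum_(z in Z) #|out z :&: Y| <= #|Z| * 2.
    rewrite -sum_nat_const; apply: leq_sum => z /small; lia.
  have YZ : #|Y| * #|Z| <= #|Y| + #|Z| * 2.
    by rewrite -(sum_out_cross YA ZB) leq_add.
  have := cardY; have := cardZ.
  move: cardX cardR d_ge d_lt p6 hA hB; rewrite -/R -/A -/B => *.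
  have [Z4|Z3] := leqP 4 #|Z|.
    by have := leq_mul (leqnn #|Y|) Z4; lia.
  have [Z3'|Z2] : #|Z| = 3 \/ #|Z| = 2 by lia.
    by rewrite Z3' in YZ *; lia.
  by rewrite Z2 in YZ *; lia.
have [s0 [s1 [s2 [c0 c1 _ H]]]] := fire_contained_bip z bp.
(* Protecting a vertex of Y may save the one vertex of Z it points to. *)
pose bad := outs (Y :&: s0) :&: Z.
have cbad : #|bad :|: (s0 :&: B)| <= 1.
  have [Y0|/set0Pn[c /setIP[cY cs0]]] := eqVneq (Y :&: s0) set0.
    rewrite /bad Y0 /outs big_set0 set0I set0U; apply: leq_trans c0.
    by rewrite subset_leq_card // subsetIl.
  have s0c : s0 = [set c].
    by apply/esym/eqP; rewrite eqEcard sub1set cs0 cards1.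
  have -> : s0 :&: B = set0.
    apply/setP => x; rewrite s0c in_set0; apply/negP => /setIP[/set1P->].
    by have := subsetP YA _ cY; rewrite A_side B_side; case: (side c); case: (side u).
  rewrite setU0; apply: leq_trans (outY_Z cY); apply: subset_leq_card.
  apply: setSI; apply/subsetP => w /outsP[y /setIP[_]].
  by rewrite s0c => /set1P -> cw; rewrite inE.
pose S1 := (out z :&: Y) :\: s0.
pose S2 := (B :\ z) :\: (bad :|: (s0 :&: B) :|: s1).
have cS1 : #|out z :&: Y| <= #|S1| + 1.
  by have := cardsID s0 (out z :&: Y); have := subset_leq_card (subsetIr (out z :&: Y) s0);
     rewrite -/S1; lia.
(* The three lost vertices are [z], the one of [bad] or [s0], and the one of [s1]. *)
have cS2 : #|B| <= #|S2| + 3.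
  have := cardsID (bad :|: (s0 :&: B) :|: s1) (B :\ z).
  have := subset_leq_card (subsetIr (B :\ z) (bad :|: (s0 :&: B) :|: s1)).
  have : #|bad :|: (s0 :&: B) :|: s1| <= _ := leq_card_setU _ _.
  have := cardsD1 z B; rewrite (subsetP ZB _ zZ) -/S2; lia.
have h1 : S1 \subset out z :\: s0 by rewrite setSD // subsetIl.
have [y0 y0S] : exists y, y \in S1.
  by apply/set0Pn; rewrite -card_gt0; move: cS1 z3; cards_lia.
have h2 : S2 \subset outs S1 :\: (s0 :|: s1).
  apply/subsetP => b /setDP[/setD1P[bz bB] /setUP nb].
  rewrite inE; apply/andP; split.
    apply/negP => /setUP[bs|bs]; apply: nb; [left|by right].
    by apply/setUP; right; apply/setIP.
  have [bX|bX] := boolP (b \in X).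
    apply/outsP; exists y0 => //; apply: arcYX => //.
    by move: y0S => /setDP[/setIP[]].
  have bZ : b \in Z by rewrite inE bX.
  have [y yY yb] := dom b bZ; apply/outsP; exists y => //.
  have ys0 : y \notin s0.
    apply/negP => ys; apply: nb; left; apply/setUP; left; apply/setIP; split=> //.
    by apply/outsP; exists y => //; apply/setIP.
  rewrite !inE ys0 /=; apply/andP; split; last by move: yY; rewrite !inE.
  (* The only arc from [y] into [Z] goes to [b], which differs from [z], so the arc between [y] and
     [z] starts at [z] and [y] burns. *)
  rewrite arc_total; last first.
    by move: (subsetP YA _ yY) (subsetP ZB _ zZ); rewrite A_side B_side => /eqP -> /eqP ->;
       rewrite negbK.
  apply/negP => yz; have /card_le1P := outY_Z yY.
  have zm : z \in out y :&: Z by apply/setIP; rewrite inE.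
  have bm : b \in out y :&: Z by apply/setIP; rewrite inE.
  by move=> /(_ z zm b); rewrite bm inE (negPf bz).
have zS2 : z \notin S2 by rewrite !inE eqxx andbF.
have := H S1 S2 set0 h1 h2 zS2 (sub0set _).
by rewrite -setI_eq0 setI0 => /(_ (eqxx _)); rewrite cards0; move: hB z3 cS1 cS2; rewrite -/B; cards_lia.
Qed.

Let outX_R x : x \in X -> out x \subset R.
Proof. by move=> xX; apply/subsetP => w; rewrite inE => xw; apply/outsP; exists x. Qed.

Let card_setD (S s : {set T}) : #|S| = #|S :\: s| + #|s :&: S|.
Proof. by rewrite -(cardsID s S) addnC [S :&: s]setIC. Qed.

Let degree_sum_lt v0 : #|out v0| < d -> #|A| * #|B| < d * (#|A| + #|B|).
Proof.
move=> lt_d; rewrite -sum_out -card_sides mulnC -sum_nat_const.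
rewrite (bigD1 v0) //= [X in _ < X](bigD1 v0) //= -addSn leq_add //.
exact: leq_sum.
Qed.

Lemma not_dominating z : z \in Z -> (forall y, y \in Y -> (z, y) \in D) -> False.
Proof.
move=> zZ zY.
have hA : p <= #|A| by apply: side_ge.
have hB : p <= #|B| by apply: side_ge.
have cY := cardY; have cR : #|R| + d <= p := cardR.
have Yout : Y \subset out z by apply/subsetP => y /zY; rewrite inE.
(* [Y] lies in [out z], so [|Y| <= d], while [|Y| = |A| - |R| >= p - (p - d)]. All these bounds are
   therefore tight. *)
have Yd : #|Y| = d.
  by move: (subset_leq_card Yout) (out_le z) hA cY cR; cards_lia.
have cA : #|A| = p by move: Yd hA cY cR; cards_lia.
have {}cR : #|R| + d = p by move: Yd cA cY; cards_lia.
have [s0 [s1 [s2 [c0 c1 c2 H]]]] := fire_contained_bip z bp.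
have p0 := card_parts s0; have p1 := card_parts s1; have p2 := card_parts s2.
pose Y' := Y :\: s0; pose X' := X :\: (s0 :|: s1).
have cY' : d = #|Y'| + #|s0 :&: Y| by rewrite -Yd (card_setD Y s0).
have cX' : #|X| <= #|X'| + (#|s0 :&: X| + #|s1 :&: X|).
  by rewrite (card_setD X (s0 :|: s1)) leq_add2l setIUl leq_card_setU.
have Y'Y : Y' \subset Y by apply: subsetDl.
have h1 : Y' \subset out z :\: s0 by apply: setSD.
have cX := cardX; have dge := d_ge; have dlt := d_lt.
(* [X] and [Y] have [2 * d - 1] vertices together, and [s0], [s1] save at most two of them. *)
have Xs : d.*2 <= #|X'| + #|Y'| + 3.
  by move: cX' cY' cX p0 p1 c0 c1; cards_lia.
have d3 : 3 <= d by move: p6 dge; cards_lia.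
have cY'1 : d <= #|Y'| + 1 by move: cY' p0 c0; cards_lia.
have [y0 y0Y] : exists y, y \in Y'.
  by apply/set0Pn; rewrite -card_gt0; move: cY'1 d3; cards_lia.
have XY' : X \subset outs Y'.
  apply/subsetP => x xX; apply/outsP; exists y0 => //.
  by apply: arcYX => //; apply: (subsetP Y'Y).
have zout : z \notin outs Y'.
  apply/negP => /outsP[y /(subsetP Y'Y) /zY zy].
  by apply/negP; apply: arc_asym.
have h2 : X' \subset outs Y' :\: (s0 :|: s1) by apply: setSD.
have zX' : z \notin X'.
  by apply: contra zout => /setDP[/(subsetP XY')].
have YR (S3 : {set T}) : S3 \subset R -> [disjoint Y' & S3].
  move=> S3R; rewrite disjoints_subset; apply: subset_trans Y'Y _.
  by apply/subsetP => y /setDP[_ yR]; rewrite inE; apply: contra yR; apply: (subsetP S3R).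
have fireX : 1 + #|Y'| + #|X'| < p.
  have := H Y' X' set0 h1 h2 zX' (sub0set _) (YR _ (sub0set _)).
  by rewrite cards0 addn0.
have fireXR x : x \in X' ->
    1 + #|Y'| + #|X'| + #|out x :\: (s0 :|: s1 :|: s2)| < p.
  move=> xX'; have xX : x \in X by move: xX' => /setDP[].
  apply: H => //.
    by apply: setSD; apply/subsetP => w; rewrite inE => xw; apply/outsP; exists x.
  by apply: YR; apply: subset_trans (subsetDl _ _) (outX_R xX).
have cut3 (S : {set T}) : S \subset R ->
    #|S| <= #|S :\: (s0 :|: s1 :|: s2)| + (#|s0 :&: R| + #|s1 :&: R| + #|s2 :&: R|).
  move=> SR; rewrite (card_setD S (s0 :|: s1 :|: s2)) leq_add2l.
  apply: leq_trans (subset_leq_card (setIS _ SR)) _.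
  rewrite !setIUl; apply: leq_trans (leq_card_setU _ _) _.
  by rewrite leq_add2r leq_card_setU.
have [dp|dp] : d.*2 = p \/ d.*2 = p.+1 by move: fireX Xs dge; cards_lia.
  have reg v : #|out v| = d.
    apply/eqP; rewrite eqn_leq out_le leqNgt; apply/negP => /degree_sum_lt.
    by have := leq_mul (leqnn d) hB; rewrite cA -dp; cards_lia.
  (* A burning [x] in [X] would spread to its [d] out-neighbours in [R]: with at most three vertices
     saved in all, at least [3 * d - 3 >= p] would burn. *)
  have [X0|/set0Pn[x xX']] := eqVneq X' set0; last first.
    have xX : x \in X by move: xX' => /setDP[].
    move: (fireXR x xX') (cut3 _ (outX_R xX)) cX' cY' cX p0 p1 p2 c0 c1 c2 dp d3.
    by rewrite reg; cards_lia.
  have X'0 : #|X'| = 0 by rewrite X0 cards0.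
  (* Saving all of [X] uses up both [s0] and [s1], so [d = 3] and [p = 6], and the whole of [Y]
     burns. *)
  have s0X : s0 \subset X.
    apply/setIidPl/eqP; rewrite eqEcard subsetIl /=.
    by move: X'0 cX' cX p0 p1 c0 c1 d3; cards_lia.
  have s1X : s1 \subset X.
    apply/setIidPl/eqP; rewrite eqEcard subsetIl /=.
    by move: X'0 cX' cX p0 p1 c0 c1 d3; cards_lia.
  have Y'E : Y' = Y.
    apply/eqP; rewrite eqEcard subsetDl /=.
    by move: X'0 cX' cX p0 p1 c0 c1 d3 Yd cY'; cards_lia.
  pose V := outs Y' :\: (s0 :|: s1).
  have zV : z \notin V by apply: contra zout => /setDP[].
  have := H Y' V set0 h1 (subxx _) zV (sub0set _) (YR _ (sub0set _)).
  rewrite cards0 => fireV.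
  have outV y : y \in Y -> out y :\: X != set0 /\ out y :\: X \subset V.
    move=> yY; split.
      rewrite -card_gt0; have := cardsID X (out y).
      by move: (subset_leq_card (subsetIr (out y) X)) cX; rewrite reg; cards_lia.
    apply: setDSS; last by rewrite subUset s0X.
    by apply/subsetP => w; rewrite inE => yw; apply/outsP; exists y; rewrite ?Y'E.
  have [/set0Pn[w wy0] y0V] := outV y0 (subsetP Y'Y _ y0Y).
  have wV := subsetP y0V _ wy0.
  (* [z] and the three vertices of [Y] already burn, which leaves room for one more. Then all of [Y]
     points to [w], whose three out-neighbours lie in [R], where only [s2] can protect. *)
  have VE : V = [set w].
    by apply/esym/eqP; rewrite eqEcard sub1set wV cards1 /=; move: fireV cY' cX' X'0 p0 p1 c0 c1 cX dp d3; cards_lia.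
  have Yw y : y \in Y -> (y, w) \in D.
    move=> /outV[/set0Pn[w' w'y]] /subsetP/(_ _ w'y); rewrite VE => /set1P ww'.
    by move: w'y; rewrite ww' !inE => /andP[].
  have wR : out w \subset R.
    apply/subsetP => r; rewrite inE => wr; apply: contraT => rR.
    have : r \in Y.
      have y0A := subsetP YA _ (subsetP Y'Y _ y0Y).
      have y0w := Yw _ (subsetP Y'Y _ y0Y).
      apply/setDP; split=> //; rewrite A_side (arc_side wr) (arc_side y0w) negbK.
      by rewrite -A_side.
    by move/Yw => rw; have := arc_asym wr; rewrite rw.
  have h3 : out w :\: (s0 :|: s1 :|: s2) \subset outs V :\: (s0 :|: s1 :|: s2).
    by apply: setSD; apply/subsetP => r; rewrite inE => wr; apply/outsP; exists w.
  have := H Y' V _ h1 (subxx _) zV h3 (YR _ (subset_trans (subsetDl _ _) wR)).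
  move: (cut3 _ wR) fireV cY' cX' X'0 p0 p1 p2 c0 c1 c2 cX dp d3.
  by rewrite reg VE cards1; cards_lia.
pose V := outs Y' :\: (s0 :|: s1).
have zV : z \notin V by apply: contra zout => /setDP[].
have := H Y' V set0 h1 (subxx _) zV (sub0set _) (YR _ (sub0set _)).
rewrite cards0 => fireV.
(* The set [X'] already brings the fire to [p - 1] vertices, so nothing else burns and [s0], [s1]
   are spent inside [X] and [Y]. *)
have VE : X' = V.
  by apply/eqP; rewrite eqEcard h2 /=; move: fireV Xs dp; cards_lia.
have outY'X y : y \in Y' -> out y \subset X.
  move=> yY'; apply/subsetP => w wy.
  have wB := subsetP (outY_B (subsetP Y'Y _ yY')) _ wy.
  apply: contraT => wX; have wZ : w \in Z by rewrite inE wX.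
  have : w \notin V by rewrite -VE !inE (negPf wX) andbF.
  rewrite inE; have -> : w \in outs Y' by apply/outsP; exists y; rewrite inE in wy.
  rewrite andbT negbK => /setUP[ws|ws].
    have : 0 < #|s0 :&: Z| by apply/card_gt0P; exists w; rewrite inE ws.
    by move: fireX cX' cY' cX p0 p1 c0 c1 dp; cards_lia.
  have : 0 < #|s1 :&: Z| by apply/card_gt0P; exists w; rewrite inE ws.
  by move: fireX cX' cY' cX p0 p1 c0 c1 dp; cards_lia.
have [x0 x0X'] : exists x, x \in X'.
  apply/set0Pn; rewrite -card_gt0; move: cX' cX p0 p1 c0 c1 p6 dp; cards_lia.
have x0X : x0 \in X by move: x0X' => /setDP[].
(* No further vertex may burn, so [s2] must protect every out-neighbour of [x0]. *)
have outx0 : #|out x0| <= 1.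
  move: (fireXR x0 x0X') (cut3 _ (outX_R x0X)) cX' cY' cX p0 p1 p2 c0 c1 c2 dp.
  by cards_lia.
(* The added terms bound from below how far each out-degree falls short of [d]: by 1 on [X] (as
   [|R| = d - 1]) and on [Y'], and by [d - 1] in total at [x0]. *)
have defect : \sum_(v : T) (#|out v| + ((v \in X) + (v \in Y') + (v == x0) * (d - 2)))
    <= d * (#|A| + #|B|).
  rewrite -card_sides mulnC -sum_nat_const; apply: leq_sum => v _.
  have [->|vx0] := eqVneq v x0.
    have /negPf-> : x0 \notin Y'.
      apply/negP => /(subsetP Y'Y) /(subsetP YA); have := subsetP XB _ x0X.
      by rewrite A_side B_side => /eqP ->; case: (side u).
    by rewrite x0X; move: outx0 d3; cards_lia.
  rewrite mul0n addn0; have [vX|vX] := boolP (v \in X).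
    have /negPf-> : v \notin Y'.
      apply/negP => /(subsetP Y'Y) /(subsetP YA); have := subsetP XB _ vX.
      by rewrite A_side B_side => /eqP ->; case: (side u).
    by move: (subset_leq_card (outX_R vX)) cR dp; cards_lia.
  have [vY|vY] := boolP (v \in Y'); last by rewrite addn0.
  by move: (subset_leq_card (outY'X _ vY)) cX; cards_lia.
move: defect; rewrite !big_split /= (sum_out (side u)) -/A -/B.
have sum_mem (S : {set T}) : \sum_v (v \in S) = #|S|.
  by rewrite -sum1_card [RHS]big_mkcond; apply: eq_bigr => v _; case: (v \in S).
rewrite !sum_mem -big_distrl /=.
have -> : \sum_v (v == x0) = 1.
  by rewrite (bigD1 x0) //= eqxx big1 // => v /negPf ->.
have pX : p = #|X|.*2.+1 by move: cX dp; cards_lia.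
(* With [|A| = p = 2 * d - 1] and [|B| >= p], the total shortfall of at least [3 * d - 4] leaves
   only [d <= 3], against [p >= 6]. *)
by move: (leq_mul (leqnn #|X|) hB) cY'1 p6; rewrite cA -cX pX; cards_lia.
Qed.

End Extremal.

Lemma bip_tournament_beta_ge p :
  6 <= p -> (forall b, p <= #|on b|) -> p <= beta D 1.
Proof.
move=> p6 hp; rewrite leqNgt; apply/negP => bp.
have [v0 _] : exists x, x \in on true.
  by apply/card_gt0P; apply: leq_trans (hp true); lia.
case: (@arg_maxnP T v0 xpredT (fun v => #|out v|) isT) => u _ umax.
have out_le v : #|out v| <= #|out u| by apply: umax.
have d0 : 0 < #|out u|.
  rewrite lt0n; apply/negP => /eqP u0.
  have : \sum_(v : T) #|out v| = 0.
    by apply: big1 => v _; apply/eqP; rewrite -leqn0 -u0.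
  by rewrite (sum_out true); have := hp true; have := hp (~~ true); nia.
have [X Xu [cX cR]] := small_second_neighbourhood bp d0.
have d_lt : #|out u| < p by apply: out_lt => //; apply: arc_loop.
apply: (not_all_dominated p6 hp bp out_le d_lt Xu cX cR) => z zZ.
apply/exists_inP; apply: contraT => /exists_inPn zY.
case: (not_dominating p6 hp bp out_le d_lt Xu cX cR zZ) => y yY.
rewrite arc_total; first exact: zY.
by move: yY zZ; rewrite !inE => /andP[_ /eqP->] /andP[_ /eqP->]; rewrite negbK.
Qed.

(** With parts of sizes [m] and [n] and all out-degrees at most [m - 1], the degree sum gives
    [m n <= (m + n) (m - 1)], that is [n <= m (m - 1)]. *)
Lemma bip_tournament_beta_ge_unbalanced b :
  #|on b| * (#|on b| - 1) < #|on (~~ b)| -> #|on b| <= beta D 1.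
Proof.
set m := #|on b|; set n := #|on (~~ b)|.
case Em : m => [//|k] lt_n; rewrite leqNgt; apply/negP => bm.
have : \sum_(v : T) #|out v| <= #|T| * k.
  rewrite -sum_nat_const; apply: leq_sum => v _.
  by rewrite -ltnS; apply: out_lt bm (arc_loop v).
by rewrite (sum_out b) (card_sides b) -/m -/n Em; lia.
Qed.

End BipartiteTournament.

(** * Upper bound: all arcs directed to one side *)

Section OneSided.
Variables (T : finType) (D : {set T * T}).

(** Protecting [w] at the first step closes the only exit from [I], so the fire never leaves [I]. *)
Lemma min_burnt_le_protect v w (I : {set T}) :
    v \in I -> w \notin I -> outs D I \subset w |: I ->
  min_burnt D 1 v <= #|I|.
Proof.
move=> vI wI outI; pose s t : {set T} := if t is 0 then [set w] else set0.
have burnI t : burning D s v t \subset I.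
  elim: t => [|t IHt] /=; first by rewrite sub1set.
  rewrite subUset IHt; apply/subsetP => x; rewrite inE => /andP[xP].
  case/exists_inP => u /(subsetP IHt) uI ux.
  have /setU1P[xw|//] : x \in w |: I by apply/(subsetP outI)/outsP; exists u.
  by case/bigcupP: xP; exists ord0; rewrite // xw inE.
apply/min_burntP; exists s => [t|t]; last exact: subset_leq_card.
apply/andP; split; first by case: t => [|t]; rewrite ?cards1 ?cards0.
case: t => [|t]; last by rewrite disjoints_subset sub0set.
rewrite disjoints1 /protected big_ord0 setU0 inE.
by apply: contra wI => /eqP ->.
Qed.

Lemma beta_one_sided (side : T -> bool) b :
    (forall x y, (x, y) \in D -> side x = b /\ side y = ~~ b) ->
    0 < #|on side b| -> 0 < #|on side (~~ b)| ->
  beta D 1 <= #|on side (~~ b)|.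
Proof.
move=> arcs /card_gt0P[x xb] /card_gt0P[y yb]; apply/bigmax_leqP => v _.
move: xb yb; rewrite !inE => /eqP xb /eqP yb.
have [vb|vb] := eqVneq (side v) b.
  (* The saved vertex [y] makes up for [v] itself, which gives exactly the size of the sink side. *)
  apply: leq_trans (@min_burnt_le_protect v y (v |: (on side (~~ b) :\ y)) _ _ _) _.
  - by rewrite !inE eqxx.
  - by rewrite !inE eqxx orbF; apply/eqP => yv; move: yb; rewrite yv vb; case: (b).
  - apply/subsetP => w /outsP[u _ /arcs[_ wb]].
    by rewrite !inE wb eqxx andbT orbCA orbN orbT.
  - rewrite [leqRHS](cardsD1 y) [y \in _]inE yb eqxx cardsU1 leq_add2r.
    by case: (_ \notin _).
apply: leq_trans (@min_burnt_le_protect v x [set v] _ _ _) _.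
- by rewrite inE.
- by rewrite inE; apply: contraNneq vb => <-; rewrite xb.
- apply/subsetP => w /outsP[u /set1P -> /arcs[vb' _]].
  by rewrite vb' eqxx in vb.
- by rewrite cards1; apply/card_gt0P; exists y; rewrite inE yb.
Qed.

End OneSided.

(** * Transfer to orientations of [Kpq p q] *)

Section CompleteBipartite.
Variables p q : nat.

Definition Kpq_side (x : Kpq p q) : bool := if x is inl _ then true else false.

Lemma card_Kpq_side b : #|on Kpq_side b| = if b then p else q.
Proof.
case: b.
  rewrite -[RHS](card_ord p) -cardsT -(card_imset _ (@inl_inj 'I_p 'I_q)).
  apply: eq_card => -[i|j]; rewrite [LHS]inE /=; first by rewrite imset_f ?inE.
  by apply/esym/negP => /imsetP[].
rewrite -[RHS](card_ord q) -cardsT -(card_imset _ (@inr_inj 'I_p 'I_q)).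
apply: eq_card => -[i|j]; rewrite [LHS]inE /=; last by rewrite imset_f ?inE.
by apply/esym/negP => /imsetP[].
Qed.

Lemma Kpq_edgeE (x y : Kpq p q) : edge x y = (Kpq_side y == ~~ Kpq_side x).
Proof. by case: x y => [i|i] [j|j]. Qed.

Section Orientation.
Variable D : {set Kpq p q * Kpq p q}.
Hypothesis orD : is_orientation D.

Lemma Kpq_arc_side x y : (x, y) \in D -> Kpq_side y = ~~ Kpq_side x.
Proof.
move=> xy; have /forallP/(_ x)/forallP/(_ y) := orD.
by rewrite xy Kpq_edgeE; case: eqP.
Qed.

Lemma Kpq_arc_total x y :
  Kpq_side y = ~~ Kpq_side x -> ((x, y) \in D) = ((y, x) \notin D).
Proof.
move=> xy; have /forallP/(_ x)/forallP/(_ y) := orD.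
by rewrite Kpq_edgeE xy eqxx; case: (_ \in D); case: (_ \in D).
Qed.

End Orientation.

Lemma obeta_Kpq_le b : 0 < p -> 0 < q ->
  obeta (Kpq p q) 1 <= if b then p else q.
Proof.
move=> p0 q0; rewrite -card_Kpq_side.
pose D := [set x : Kpq p q * Kpq p q | (Kpq_side x.1 == ~~ b) && (Kpq_side x.2 == b)].
have orD : is_orientation D.
  apply/forallP => x; apply/forallP => y; rewrite Kpq_edgeE !inE /=.
  by case: (Kpq_side x); case: (Kpq_side y); case: (b).
apply: leq_trans (bigminn_leq _ _ orD) _.
have := @beta_one_sided _ D Kpq_side (~~ b); rewrite negbK; apply.
- by move=> x y; rewrite inE => /andP[/eqP -> /eqP ->].
- by rewrite card_Kpq_side; case: (b).
- by rewrite card_Kpq_side; case: (b).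
Qed.

Lemma obeta_Kpq_ge k : k <= p ->
  (forall D : {set Kpq p q * Kpq p q}, is_orientation D -> k <= beta D 1) ->
  k <= obeta (Kpq p q) 1.
Proof.
move=> kp kD; apply: (big_ind (fun m => k <= m)) => [|m n hm hn|D orD].
- by rewrite card_sum !card_ord (leq_trans kp) ?leq_addr.
- by rewrite leq_min hm.
- exact: kD.
Qed.

End CompleteBipartite.

Theorem theorem3p10 (p q : nat) (hp : 0 < p) (hq : 0 < q)
    (hpq : (6 <= p /\ 6 <= q) \/ p * (p - 1) < q) :
  obeta (Kpq p q) 1 = minn p q.
Proof.
apply/eqP; rewrite eqn_leq; apply/andP; split.
  by rewrite leq_min (obeta_Kpq_le true) // (obeta_Kpq_le false).
apply: obeta_Kpq_ge => [|D orD]; first exact: geq_minl.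
have arc_side := Kpq_arc_side orD; have arc_total := Kpq_arc_total orD.
case: hpq => [[p6 q6]|lt_q].
  apply: (bip_tournament_beta_ge arc_side arc_total) => [|b]; first by rewrite leq_min p6.
  by rewrite card_Kpq_side; case: b; rewrite ?geq_minl ?geq_minr.
apply: leq_trans (geq_minl _ _) _.
have := @bip_tournament_beta_ge_unbalanced _ _ _ arc_side arc_total true.
by rewrite !card_Kpq_side; apply.
Qed.
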